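(* Let $m,n\ge1$ and let $\mathcal M_{n,m}$ be the set of Dyck paths of semilength $nm$ in which every maximal run of consecutive up-steps has length divisible by $m$, ordered by the Tamari order (the $m$-Tamari lattice). Then the map $[P,Q]\mapsto \mathrm{IP}(P,Q)$ restricts to a bijection from the set of pairs $P\le Q$ with $P,Q\in\mathcal M_{n,m}$ onto the set of Tamari interval-posets $\triangleleft$ of size $nm$ satisfying, for every $1\le i\le n$, $im\triangleleft im-1\triangleleft \cdots\triangleleft im-(m-1)$.
   Context: A Dyck path of semilength $N$ is a word in up-steps $U$ and down-steps $D$ with $N$ of each, every prefix having at least as many $U$ as $D$; each up-step is matched with the first later down-step returning to its starting height. Tamari order: a rotation takes a down-step $D$ immediately followed by an up-step, lets $W$ be the shortest nonempty factor starting right after this $D$ that is itself a Dyck path, and replaces $DW$ by $WD$; the Tamari order is the reflexive–transitive closure. Label up-steps $1,\dots,N$ left to right. $\mathrm{dec}(P)=\{(j,i): j\ne i,\ \text{up-step } j \text{ lies strictly between up-step } i \text{ and its matching down-step}\}$; $\mathrm{inc}(Q)$ is the transitive closure of the relation containing $(i,k)$ whenever $k$ is the first up-step after the down-step matched with $i$. $\mathrm{IP}(P,Q)$ is the reflexive transitive closure of $\mathrm{dec}(P)\cup\mathrm{inc}(Q)$, written $x\triangleleft y$. A Tamari interval-poset of size $N$ is a partial order $\triangleleft$ on $[N]$ such that for all $a<b<c$: $a\triangleleft c\Rightarrow b\triangleleft c$ and $c\triangleleft a\Rightarrow b\triangleleft a$. *)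

(* Defs.v *)
From Stdlib Require Import Relations.
From mathcomp Require Import all_boot.
Set Implicit Arguments. Unset Strict Implicit. Unset Printing Implicit Defensive.

(* A word in U/D is a [seq bool]: [true] = up-step U, [false] = down-step D.
   Positions in a word are 0-based; up-step labels are 1-based. *)

Definition prefix_ok (P : seq bool) : bool :=
  all (fun k => count negb (take k P) <= count id (take k P)) (iota 0 (size P).+1).

Definition dyckb (P : seq bool) : bool :=
  (count id P == count negb P) && prefix_ok P.

Definition is_dyck (N : nat) (P : seq bool) : bool :=
  (count id P == N) && (count negb P == N) && prefix_ok P.

(* position of the matching down-step of the step at position p:
   the end of the shortest nonempty balanced factor starting at p *)
Definition mate (P : seq bool) (p : nat) : nat :=
  p + find (fun k => let s := take k.+1 (drop p P) in count id s == count negb s)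
           (iota 0 (size P)).

Definition upos (P : seq bool) (j : nat) : nat :=
  nth 0 [seq i <- iota 0 (size P) | nth false P i] j.-1.

Definition nup (P : seq bool) : nat := count id P.

Definition dec_rel (P : seq bool) (j i : nat) : Prop :=
  [/\ 1 <= i <= nup P, 1 <= j <= nup P, j != i &
      upos P i < upos P j < mate P (upos P i)].

Definition inc_base (Q : seq bool) (i k : nat) : Prop :=
  [/\ 1 <= i <= nup Q, 1 <= k <= nup Q,
      mate Q (upos Q i) < upos Q k &
      (forall k', 1 <= k' < k -> upos Q k' < mate Q (upos Q i))].

Definition inc_rel (Q : seq bool) : relation nat := clos_trans nat (inc_base Q).

Definition IP (P Q : seq bool) : relation nat :=
  clos_refl_trans nat (fun x y => dec_rel P x y \/ inc_rel Q x y).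

Definition rotation (P Q : seq bool) : Prop :=
  exists u W v,
    [/\ P = u ++ false :: W ++ v, Q = u ++ W ++ false :: v,
        (head false W = true /\ W != [::]), dyckb W &
        (forall k, 0 < k < size W -> ~~ dyckb (take k W))].

Definition tamari_le : relation (seq bool) := clos_refl_trans _ rotation.

Definition run_len (P : seq bool) (p : nat) : nat := find negb (drop p P).

Definition in_M (n m : nat) (P : seq bool) : Prop :=
  is_dyck (n * m) P /\
  (forall p, p < size P -> nth false P p ->
     (p == 0) || ~~ nth false P p.-1 -> m %| run_len P p).

Definition interval_poset (N : nat) (R : relation nat) : Prop :=
  [/\ (forall x, 1 <= x <= N -> R x x),
      (forall x y, 1 <= x <= N -> 1 <= y <= N -> R x y -> R y x -> x = y),
      (forall x y z, 1 <= x <= N -> 1 <= y <= N -> 1 <= z <= N ->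
          R x y -> R y z -> R x z) &
      (forall a b c, 1 <= a -> a < b -> b < c -> c <= N ->
          (R a c -> R b c) /\ (R c a -> R b a))].

Definition chain_cond (n m : nat) (R : relation nat) : Prop :=
  forall i t, 1 <= i <= n -> t.+1 < m -> R (i * m - t) (i * m - t.+1).

Definition rel_eq_on (N : nat) (R S : relation nat) : Prop :=
  forall x y, 1 <= x <= N -> 1 <= y <= N -> (R x y <-> S x y).

(* Main.v *)
(* A Dyck path is the word of a unique binary tree, with word (Node a b) = word a, U, word b, D;
   the labels of its up-steps are the in-order labels of the nodes.  It is encoded by the function e
   sending i to the last up-step lying before the step matched with i, and the functions that arise
   are exactly the bracketings of [1, N].  In these terms j is a descendant of i iff i < j <= e i, the
   basic increasing relations are i -> e i + 1, and the Tamari order is the pointwise order: tree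
   rotations increase e, and if e <= e' pointwise then the root of the larger tree lies on the left
   spine of the smaller one, where rotations bring it to the root.  For e <= f, IP is the disjoint
   union of equality, the pairs y < x <= e y, and the pairs x < y with f z < y for all z in [x, y);
   both functions can be read off this relation, and off any interval-poset.  Finally, all runs of
   up-steps have length divisible by m iff i < e i for every i not divisible by m, which is the
   chain condition. *)
Require Import Defs.
From Stdlib Require Import Relations.
From Stdlib Require Import ClassicalEpsilon.
From mathcomp Require Import all_boot.
From mathcomp Require Import zify.
Set Implicit Arguments.
Unset Strict Implicit.

Ltac cat_norm := repeat progress rewrite /= -?catA ?cats0.

(** * Binary trees and their Dyck words *)

Inductive tree := Leaf | Node of tree & tree.

Fixpoint tsize t := if t is Node a b then (tsize a + tsize b).+1 else 0.

Fixpoint word t : seq bool :=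
  if t is Node a b then word a ++ true :: word b ++ [:: false] else [::].

Fixpoint rsizes t : seq nat :=
  if t is Node a b then rsizes a ++ tsize b :: rsizes b else [::].

(** The right subtree of node [i] carries the labels directly after [i], so this is its largest
    label, or [i] itself if that subtree is empty. *)
Definition last_desc t i := i + nth 0 (rsizes t) i.-1.

Lemma size_rsizes t : size (rsizes t) = tsize t.
Proof. by elim: t => //= a IHa b IHb; rewrite size_cat /= IHa IHb addnS. Qed.

Lemma count_up_word t : count id (word t) = tsize t.
Proof.
elim: t => //= a IHa b IHb.
by rewrite count_cat /= count_cat /= IHa IHb; lia.
Qed.

Lemma count_down_word t : count negb (word t) = tsize t.
Proof.
elim: t => //= a IHa b IHb.
by rewrite count_cat /= count_cat /= IHa IHb; lia.
Qed.

Lemma word_prefix t k : count negb (take k (word t)) <= count id (take k (word t)).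
Proof.
elim: t k => //= a IHa b IHb k.
rewrite take_cat; case: ifP => // _.
rewrite !count_cat count_up_word count_down_word leq_add2l.
case: (k - _) => //= l.
rewrite take_cat; case: ifP => _; first by have := IHb l; lia.
rewrite !count_cat count_up_word count_down_word.
by case: (l - _) => [|l'] /=; lia.
Qed.

Lemma prefix_okP P :
  reflect (forall k, count negb (take k P) <= count id (take k P)) (prefix_ok P).
Proof.
apply: (iffP allP) => [H k | H k _]; last exact: H.
have [lek|ltk] := leqP k (size P); first by apply: H; rewrite mem_iota; lia.
rewrite take_oversize; last exact: ltnW.
by have := H (size P); rewrite take_size; apply; rewrite mem_iota; lia.
Qed.

Lemma word_dyck t : is_dyck (tsize t) (word t).
Proof.
by rewrite /is_dyck count_up_word count_down_word eqxx; apply/prefix_okP/word_prefix.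
Qed.

(** The stack of a parser, top first: each entry is a finished left subtree followed by an up-step
    that is still unmatched. *)
Fixpoint stack_word (s : seq tree) : seq bool :=
  if s is a :: s' then stack_word s' ++ word a ++ [:: true] else [::].

Lemma count_stack_word s : count id (stack_word s) = count negb (stack_word s) + size s.
Proof.
elim: s => //= a s IH.
by rewrite !count_cat /= IH count_up_word count_down_word; lia.
Qed.

(* Shift-reduce parsing: an up-step pushes the current tree, a down-step pops one. *)
Lemma prefix_parse P : prefix_ok P -> exists s t, P = stack_word s ++ word t.
Proof.
move/prefix_okP; elim/last_ind: P => [|P b IH] H; first by exists [::], Leaf.
have /IH [s [t eP]] : forall k, count negb (take k P) <= count id (take k P).
  move=> k; have [lek|ltk] := leqP k (size P).
    by have := H k; rewrite -cats1 takel_cat.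
  by have := H (size P); rewrite -cats1 takel_cat // take_size take_oversize // ltnW.
case: b H => H.
  by exists (t :: s), Leaf; rewrite eP -cats1 /= cats0 -catA.
case: s eP => [|a s] eP.
  have := H (size P).+1; rewrite take_oversize ?size_rcons //.
  by rewrite -cats1 eP !count_cat /= count_up_word count_down_word; lia.
by exists s, (Node a t); rewrite eP -cats1; cat_norm.
Qed.

Lemma dyck_word N P : is_dyck N P -> exists2 t, P = word t & tsize t = N.
Proof.
case/andP=> /andP[/eqP cu /eqP cd] /prefix_parse [s [t eP]].
have s0 : size s = 0.
  move: cu cd; rewrite eP !count_cat count_up_word count_down_word count_stack_word; lia.
by case: s s0 eP => //= _ eP; exists t => //; rewrite -cu eP count_up_word.
Qed.

(** Locates the node of label [k.+1]: between its up-step and the matching down-step stands exactly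
    the word of its right subtree. *)
Lemma split_word t k : k < tsize t -> exists u a v,
  [/\ word t = u ++ true :: word a ++ false :: v, count id u = k
    & tsize a = nth 0 (rsizes t) k].
Proof.
elim: t k => //= a IHa b IHb k ltk.
rewrite nth_cat size_rsizes.
case: ltngtP => [lta|gta|->].
- have [u [c [v [-> cu <-]]]] := IHa k lta.
  by exists u, c, (v ++ true :: word b ++ [:: false]); split; rewrite // -catA /= -catA.
- have ltb : k - (tsize a).+1 < tsize b by lia.
  have [u [c [v [-> cu sc]]]] := IHb _ ltb.
  exists (word a ++ true :: u), c, (v ++ [:: false]).
  split; first by cat_norm.
    by rewrite count_cat /= count_up_word cu; lia.
  by rewrite sc (_ : k - tsize a = (k - (tsize a).+1).+1) //; lia.
- by exists (word a), b, [::]; rewrite count_up_word subnn.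
Qed.

(** * Positions of up-steps and of their mates *)

Lemma upos_cat u w : upos (u ++ true :: w) (count id u).+1 = size u.
Proof.
rewrite /upos /= size_cat iotaD filter_cat /= add0n.
rewrite nth_cat nth_cat ltnn subnn /=.
have e : [seq i <- iota 0 (size u) | nth false (u ++ true :: w) i]
       = [seq i <- iota 0 (size u) | nth false u i].
  by apply: eq_in_filter => i; rewrite mem_iota => hi; rewrite nth_cat ifT //; lia.
have c : size [seq i <- iota 0 (size u) | nth false u i] = count id u.
  rewrite size_filter -[in RHS](mkseq_nth false u) /mkseq count_map.
  by apply: eq_count.
by rewrite e c ltnn subnn.
Qed.

Lemma count_take_le (T : Type) (a : pred T) k s : count a (take k s) <= count a s.
Proof. by rewrite -[in leqRHS](cat_take_drop k s) count_cat leq_addr. Qed.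

Lemma upos_word_lt t j p : 1 <= j <= tsize t ->
  (upos (word t) j < p) = (j <= count id (take p (word t))).
Proof.
case: j => // j /= ltj.
have [u [a [v [-> cu _]]]] := split_word ltj.
rewrite -cu upos_cat take_cat.
case: (ltngtP p (size u)) => h.
- by have := count_take_le id p u; lia.
- rewrite count_cat; case e: (p - size u) => [|l] /=; lia.
- by rewrite h subnn take0 cats0; lia.
Qed.

Lemma upos_ltn t i j : 1 <= i <= tsize t -> 1 <= j <= tsize t ->
  (upos (word t) i < upos (word t) j) = (i < j).
Proof.
case: i => // i /= hi hj; rewrite ltnNge -[in RHS]ltnS ltnNge -ltnS; congr (~~ _).
rewrite upos_word_lt //.
have [u [a [v [-> cu _]]]] := split_word hi.
rewrite -cu upos_cat take_cat ltnNge leqnSn /= subSnn /= take0 count_cat.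
by rewrite /= addn1.
Qed.

Lemma find_iota0 (a : pred nat) n N :
  n < N -> (forall k, k < n -> ~~ a k) -> a n -> find a (iota 0 N) = n.
Proof.
move=> ltn na an.
rewrite (_ : N = n + (N - n).-1.+1); last by lia.
rewrite iotaD find_cat ifF /= ?add0n ?an ?size_iota ?addn0 //.
by apply/hasP => -[k]; rewrite mem_iota => /na /negP.
Qed.

Lemma mate_cat u a v :
  mate (u ++ true :: word a ++ false :: v) (size u) = size u + (size (word a)).+1.
Proof.
rewrite /mate; congr (_ + _); rewrite drop_size_cat //.
apply: find_iota0 => [|k ltk|].
- by rewrite size_cat /= size_cat /=; lia.
(* A shorter factor is an up-step followed by a prefix of [word a], so its up-steps are in strict
   majority. *)
- rewrite /= takel_cat //.
  by have := word_prefix a k; lia.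
- by rewrite /= take_cat ltnNge leqnSn /= subSnn /= take0 !count_cat /=
    count_up_word count_down_word; lia.
Qed.

(** Before the mate of [i] stand the up-steps up to [i] and those of its right subtree. Both cuts
    give the same count because the step at [p] is down; each serves one direction of comparison. *)
Lemma count_take_mate t i : 1 <= i <= tsize t ->
  let p := mate (word t) (upos (word t) i) in
  count id (take p (word t)) = last_desc t i /\
  count id (take p.+1 (word t)) = last_desc t i.
Proof.
case: i => // i /= lti; rewrite /last_desc /=.
have [u [a [v [-> cu <-]]]] := split_word lti.
rewrite -cu upos_cat mate_cat.
rewrite !take_cat.
have -> : (size u + (size (word a)).+1 < size u) = false by lia.
have -> : ((size u + (size (word a)).+1).+1 < size u) = false by lia.
rewrite -addnS !addKn /= !take_cat ltnn subnn take0.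
have -> : ((size (word a)).+1 < size (word a)) = false by lia.
rewrite subSnn /= take0 !count_cat /= !count_cat /= count_up_word; lia.
Qed.

Lemma upos_lt_mate t i j : 1 <= i <= tsize t -> 1 <= j <= tsize t ->
  (upos (word t) j < mate (word t) (upos (word t) i)) = (j <= last_desc t i).
Proof. by move=> hi hj; rewrite upos_word_lt // (count_take_mate hi).1. Qed.

Lemma mate_lt_upos t i j : 1 <= i <= tsize t -> 1 <= j <= tsize t ->
  (mate (word t) (upos (word t) i) < upos (word t) j) = (last_desc t i < j).
Proof.
move=> hi hj; rewrite ltnNge -ltnS upos_word_lt // (count_take_mate hi).2.
by rewrite ltnNge.
Qed.

(** * Trees as bracketings *)

Lemma last_desc_left a b i : 1 <= i <= tsize a ->
  last_desc (Node a b) i = last_desc a i.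
Proof. by case: i => // i /= h; rewrite /last_desc /= nth_cat size_rsizes h. Qed.

Lemma last_desc_root a b : last_desc (Node a b) (tsize a).+1 = tsize (Node a b).
Proof. by rewrite /last_desc /= nth_cat size_rsizes ltnn subnn. Qed.

Lemma last_desc_right a b i : 1 <= i ->
  last_desc (Node a b) ((tsize a).+1 + i) = (tsize a).+1 + last_desc b i.
Proof.
case: i => // i _; rewrite /last_desc /= nth_cat size_rsizes ifF; last by lia.
by rewrite addKn addnA.
Qed.

(** Indexing by a label and its [last_desc] value lets one case analysis rewrite both. *)
Variant node_label (a b : tree) : nat -> nat -> Prop :=
| LeftLabel i of 1 <= i <= tsize a : node_label a b i (last_desc a i)
| RootLabel : node_label a b (tsize a).+1 (tsize a + tsize b).+1
| RightLabel i of 1 <= i <= tsize b :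
    node_label a b ((tsize a).+1 + i) ((tsize a).+1 + last_desc b i).

Lemma node_labelP a b i : 1 <= i <= tsize (Node a b) ->
  node_label a b i (last_desc (Node a b) i).
Proof.
rewrite /= => hi; case: (ltngtP i (tsize a).+1) => h.
- by rewrite last_desc_left; [constructor|]; lia.
- have -> : i = (tsize a).+1 + (i - (tsize a).+1) by lia.
  by rewrite last_desc_right; [constructor|]; lia.
- by rewrite h last_desc_root; constructor.
Qed.

Definition bracketing N (e : nat -> nat) :=
  (forall i, 1 <= i <= N -> i <= e i <= N) /\
  (forall i j, 1 <= i <= N -> i < j <= e i -> e j <= e i).

Lemma last_desc_bracketing t : bracketing (tsize t) (last_desc t).
Proof.
elim: t => [|a [Ha1 Ha2] b [Hb1 Hb2]]; first by split=> [|] [].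
have H i : 1 <= i <= tsize (Node a b) -> i <= last_desc (Node a b) i <= tsize (Node a b).
  case/node_labelP => [j hj||j hj] /=; [have := Ha1 j hj| |have := Hb1 j hj]; lia.
split=> // i j hi.
have [hj|hj] := leqP j (tsize (Node a b)); last by have := H _ hi; lia.
case/node_labelP: hi => [k hk||k hk] /=.
- have := Ha1 _ hk => h1 h2; rewrite last_desc_left; last by lia.
  exact: Ha2.
- by move=> h; have := H j; move: hj => /=; lia.
- have := Hb1 _ hk => h1 h2.
  have -> : j = (tsize a).+1 + (j - (tsize a).+1) by lia.
  by rewrite last_desc_right; first (have := Hb2 k (j - (tsize a).+1)); lia.
Qed.

Lemma last_desc_inj t t' : tsize t = tsize t' ->
  (forall i, 1 <= i <= tsize t -> last_desc t i = last_desc t' i) -> t = t'.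
Proof.
elim: t t' => [|a IHa b IHb] [|a' b'] //= sz H.
(* The root is the first label whose value is the full size, as values in the left subtree stay
   inside it. *)
have sa : tsize a = tsize a'.
  have h := H (tsize a).+1; have h' := H (tsize a').+1.
  rewrite !last_desc_root /= in h h'.
  have [b1 _] := last_desc_bracketing a; have [b1' _] := last_desc_bracketing a'.
  case: (ltngtP (tsize a) (tsize a')) => // lt.
  - by rewrite last_desc_left in h; have := b1' (tsize a).+1; lia.
  - by rewrite last_desc_left in h'; have := b1 (tsize a').+1; lia.
congr Node; [apply: IHa | apply: IHb] => // [i hi||i hi].
- by have := H i; rewrite !last_desc_left -?sa //; apply; lia.
- by lia.
- have := H ((tsize a).+1 + i); rewrite last_desc_right ?sa ?last_desc_right; lia.
Qed.

(** Counting up-steps before mates recovers [last_desc], hence the tree, from the word. *)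
Lemma word_inj : injective word.
Proof.
move=> t t' e; have sz : tsize t = tsize t' by rewrite -!count_up_word e.
apply: last_desc_inj => // i hi.
by rewrite -(count_take_mate hi).1 e (count_take_mate _).1 // -sz.
Qed.

Lemma bracketing_tree N e : bracketing N e ->
  exists2 t, tsize t = N & forall i, 1 <= i <= N -> last_desc t i = e i.
Proof.
elim/ltn_ind: N e => -[|N] IH e [H1 H2]; first by exists Leaf => // -[].
(* The root has to be the first index whose bracket reaches the end. *)
have exr : exists r, (1 <= r <= N.+1) && (e r == N.+1).
  by exists N.+1; have := H1 N.+1; lia.
case: (ex_minnP exr) => r /andP[hr /eqP er] minr.
(* If [e i >= r], nesting gives [e r <= e i], so [e i = N.+1], against the minimality of [r]. *)
have lte i : 1 <= i < r -> e i < r.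
  move=> hi; rewrite ltnNge; apply/negP => lei.
  have := H2 i r; have := H1 i; have := minr i; lia.
have [||a sa Ha] := IH r.-1 _ e; first by lia.
  split=> [i hi|i j hi hj]; first by have := lte i; have := H1 i; lia.
  by apply: H2 => //; lia.
have [||b sb Hb] := IH (N.+1 - r) _ (fun j => e (r + j) - r); first by lia.
  split=> [i hi|i j hi hj]; first by have := H1 (r + i); lia.
  by have := H2 (r + i) (r + j); have := H1 (r + i); lia.
have sz : tsize (Node a b) = N.+1 by rewrite /= sa sb; lia.
exists (Node a b) => // i; rewrite -sz.
have ra : (tsize a).+1 = r by lia.
case/node_labelP => [j hj||j hj].
- by apply: Ha; lia.
- by rewrite ra er -sz.
- by rewrite ra Hb; have := H1 (r + j); lia.
Qed.

(** * Rotations of trees and of words *)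

Inductive trot : tree -> tree -> Prop :=
| TRoot a b c : trot (Node (Node a b) c) (Node a (Node b c))
| TLeft a a' b of trot a a' : trot (Node a b) (Node a' b)
| TRight a b b' of trot b b' : trot (Node a b) (Node a b').

Definition tle := clos_refl_trans tree trot.

Lemma tle_node a a' b b' : tle a a' -> tle b b' -> tle (Node a b) (Node a' b').
Proof.
move=> ha hb; apply: (rt_trans _ _ _ (Node a' b)).
  elim: ha => [x y /(TLeft b)|x|x y z _ h1 _ h2];
    [exact: rt_step|exact: rt_refl|exact: rt_trans h1 h2].
elim: hb => [x y /(TRight a')|x|x y z _ h1 _ h2];
  [exact: rt_step|exact: rt_refl|exact: rt_trans h1 h2].
Qed.

Lemma rotation_word t t' : trot t t' -> rotation (word t) (word t').
Proof.
elim=> {t t'} [a b c|a a' b _ /= [u [W [v [-> -> h1 h2 h3]]]]|a b b' _ /= [u [W [v [-> -> h1 h2 h3]]]]].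
(* The moved factor is U, [word c], D; its proper nonempty prefixes have more up-steps than
   down-steps, so none is a Dyck path. *)
- exists (word a ++ true :: word b), (true :: word c ++ [:: false]), [::].
  split=> //=.
  + by rewrite cats0; cat_norm.
  + by cat_norm.
  + rewrite /dyckb /= !count_cat /= count_up_word count_down_word.
    by have /andP[_] := word_dyck (Node Leaf c); rewrite /= => ->; lia.
  + move=> [|k] //=; rewrite size_cat /= ltnS => hk.
    rewrite takel_cat; last by lia.
    by rewrite /dyckb /=; have := word_prefix c k; lia.
- exists u, W, (v ++ true :: word b ++ [:: false]).
  by split=> //; cat_norm.
- exists (word a ++ true :: u), W, (v ++ [:: false]).
  by split=> //; cat_norm.
Qed.

Lemma tamari_word t t' : tle t t' -> tamari_le (word t) (word t').
Proof.
elim=> [x y /rotation_word|x|x y z _ h1 _ h2];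
  [exact: rt_step|exact: rt_refl|exact: rt_trans h1 h2].
Qed.

(** * The Tamari order as a pointwise order *)

Definition desc_le t t' := tsize t = tsize t' /\
  forall i, 1 <= i <= tsize t -> last_desc t i <= last_desc t' i.

Lemma desc_le_refl t : desc_le t t.
Proof. by []. Qed.

Lemma desc_le_trans t1 t2 t3 : desc_le t1 t2 -> desc_le t2 t3 -> desc_le t1 t3.
Proof.
move=> [e1 h1] [e2 h2]; split=> [|i hi]; first by rewrite e1.
by apply: leq_trans (h1 i hi) (h2 i _); rewrite -e1.
Qed.

Lemma desc_le_node a a' b b' :
  desc_le a a' -> desc_le b b' -> desc_le (Node a b) (Node a' b').
Proof.
move=> [ea ha] [eb hb]; split=> [|i]; first by rewrite /= ea eb.
case/node_labelP => [j hj||j hj].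
- by rewrite last_desc_left ?ha // -ea.
- by rewrite ea eb last_desc_root.
- by have := hb j hj; rewrite ea last_desc_right; lia.
Qed.

(** Only the value at [(tsize a).+1] changes: it grows from the last label of [b] to the full
    size. *)
Lemma desc_le_root a b c : desc_le (Node (Node a b) c) (Node a (Node b c)).
Proof.
split=> [|i]; first by rewrite /=; lia.
case/node_labelP => [j /node_labelP hj||j hj]; first case: hj => [k hk||k hk].
- by rewrite last_desc_left.
- by rewrite last_desc_root /=; lia.
- by rewrite last_desc_right ?last_desc_left; lia.
- rewrite (_ : (tsize (Node a b)).+1 = (tsize a).+1 + (tsize b).+1) /=; last by lia.
  by rewrite last_desc_right // last_desc_root /=; lia.
- rewrite (_ : (tsize (Node a b)).+1 = (tsize a).+1 + (tsize b).+1) /=; last by lia.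
  by rewrite -!addnA last_desc_right ?last_desc_right; lia.
Qed.

(** Carries a local change of the word to the whole tree: parsing the common suffix [v] builds the
    same nodes around the smaller and the larger parts. *)
Lemma desc_le_stack v s s' x x' t : size s = size s' ->
  (forall k, k < size s -> desc_le (nth Leaf s k) (nth Leaf s' k)) -> desc_le x x' ->
  word t = stack_word s ++ word x ++ v ->
  exists2 t', stack_word s' ++ word x' ++ v = word t' & desc_le t t'.
Proof.
elim: v s s' x x' => [|[] v IH] s s' x x' sz hs hx et.
- have s0 : size s = 0.
    have := count_up_word t; have := count_down_word t.
    rewrite et cats0 !count_cat count_stack_word count_up_word count_down_word; lia.
  case: s s' s0 sz {hs} et => [|//] [|//] _ _ /=; rewrite cats0 => /word_inj ->.
  by exists x'; rewrite ?cats0.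
- have [|||t' et' ht] := IH (x :: s) (x' :: s') Leaf Leaf _ _ (desc_le_refl _).
  + by rewrite /= sz.
  + by case.
  + by rewrite et; cat_norm.
  by exists t' => //; rewrite -et'; cat_norm.
- case: s s' sz hs et => [|a s] [|a' s'] //=.
    move=> _ _ et; have := word_prefix t (size (word x)).+1.
    rewrite et take_cat ltnNge leqnSn /= subSnn /= take0.
    by rewrite !count_cat /= count_up_word count_down_word; lia.
  move=> [sz] hs et.
  have [|||t' et' ht] := IH s s' (Node a x) (Node a' x') sz.
  + by move=> k hk; apply: (hs k.+1).
  + exact: desc_le_node (hs 0 _) hx.
  + by rewrite et; cat_norm.
  by exists t' => //; rewrite -et'; cat_norm.
Qed.

Lemma word_rotation t Q : rotation (word t) Q -> exists2 t', Q = word t' & desc_le t t'.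
Proof.
case=> u [W [v [et -> [hW W0] dW sW]]].
have /prefix_parse [s [b eu]] : prefix_ok u.
  apply/prefix_okP => k; have [hk|hk] := leqP k (size u).
    by have := word_prefix t k; rewrite et takel_cat.
  have := word_prefix t (size u).
  by rewrite et takel_cat // take_size take_oversize // ltnW.
have := word_prefix t (size u).+1.
rewrite et take_cat ltnNge leqnSn /= subSnn /= take0.
rewrite eu !count_cat count_stack_word count_up_word count_down_word /=.
(* As [u] followed by a down-step is a prefix of a Dyck word, [u] has an unmatched up-step. *)
case: s eu => [|a s] eu /=; first by lia.
move=> _.
have [w eW] : exists w, W = word w.
  case/andP: dW => /eqP cW pW.
  have [|w -> _] := @dyck_word (count id W) W; last by exists w.
  by rewrite /is_dyck -cW eqxx.
case: w eW => [|w c] eW; first by rewrite eW in W0.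
(* Otherwise [word w] would be a shorter nonempty Dyck prefix of [W]. *)
have w0 : w = Leaf.
  case: w eW => // w1 w2 eW.
  have /sW : 0 < size (word (Node w1 w2)) < size W.
    by rewrite eW /= !size_cat /= !size_cat /=; lia.
  rewrite eW [word (Node (Node _ _) _)]/= take_size_cat //.
  by have /andP[/andP[/eqP c1 /eqP c2] pk] := word_dyck (Node w1 w2); rewrite /dyckb c1 c2 eqxx pk.
rewrite {}w0 in eW.
have [||t' et' ht] := @desc_le_stack v s s _ _ t erefl _ (desc_le_root a b c).
- by move=> k _; apply: desc_le_refl.
- by rewrite et eu eW; cat_norm.
by exists t' => //; rewrite -et' eW; cat_norm.
Qed.

Lemma tamari_desc_le t t' : tamari_le (word t) (word t') -> desc_le t t'.
Proof.
suff H P Q : tamari_le P Q -> forall t, P = word t -> exists2 t', Q = word t' & desc_le t t'.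
  by case/H/(_ _ erefl) => t1 /word_inj ->.
elim=> {t t' P Q} [P Q rPQ t eP|P t ->|P Q S _ IH1 _ IH2 t eP].
- by apply: word_rotation; rewrite -eP.
- by exists t.
- have [t1 e1 h1] := IH1 t eP; have [t2 e2 h2] := IH2 t1 e1.
  by exists t2 => //; apply: desc_le_trans h1 h2.
Qed.

(* The second hypothesis says that [r] lies on the left spine. *)
Lemma rotate_to_root t r : 1 <= r <= tsize t ->
  (forall i, 1 <= i < r -> last_desc t i < r) ->
  exists a b, [/\ tle t (Node a b), (tsize a).+1 = r, tsize (Node a b) = tsize t
    & forall i, 1 <= i <= tsize t -> i != r -> last_desc (Node a b) i = last_desc t i].
Proof.
elim: t => [|x IH c _] hr hlt; first by move: hr => /=; lia.
case: (ltngtP r (tsize x).+1) => h.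
- have [||a [b [xab ea sab lab]]] := IH; first by lia.
    by move=> i hi; rewrite -(@last_desc_left x c) ?hlt //; lia.
  exists a, (Node b c); split=> //.
  (* Once [r] is the root of the left subtree, one rotation at the top lifts it to the root. *)
  + apply: rt_trans (rt_step _ _ _ _ (TRoot a b c)).
    by apply: tle_node xab (rt_refl _ _ _).
  + by move: sab => /=; lia.
  move=> i /node_labelP[j hj||j hj] neq.
  + rewrite -(lab j hj neq) {lab}; rewrite -sab in hj.
    case/node_labelP: hj neq => [k hk||k hk] neq.
    * by rewrite last_desc_left.
    * by rewrite ea eqxx in neq.
    * by rewrite last_desc_right ?last_desc_left //; lia.
  + rewrite (_ : (tsize x).+1 = (tsize a).+1 + (tsize b).+1); last by move: sab => /=; lia.
    by rewrite last_desc_right // last_desc_root; move: sab => /=; lia.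
  + rewrite (_ : (tsize x).+1 = (tsize a).+1 + (tsize b).+1); last by move: sab => /=; lia.
    by rewrite -!addnA last_desc_right ?last_desc_right; lia.
(* [r] is not in the right subtree: the root would precede it with a value at least [r]. *)
- by have := hlt (tsize x).+1; rewrite last_desc_root; lia.
- exists x, c; split=> //; exact: rt_refl.
Qed.

Lemma desc_le_tle t t' : desc_le t t' -> tle t t'.
Proof.
elim: t' t => [|a' IHa b' IHb] t [sz le]; first by case: t sz {le} => //; constructor.
have [ba _] := last_desc_bracketing a'.
have [|i hi|a [b [tab ea sab lab]]] := @rotate_to_root t (tsize a').+1.
- by rewrite sz /=; lia.
(* Labels before the root of the larger tree have values before it there, hence also in [t]. *)
- have := le i; rewrite last_desc_left; last by lia.
  by have := ba i; rewrite sz /=; lia.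
apply: rt_trans tab _.
move: ea sab sz => /= [ea] sab sz; have eb : tsize b = tsize b' by lia.
apply: tle_node; [apply: IHa | apply: IHb]; split=> // i hi.
- by have := le i; have := lab i; rewrite !last_desc_left -?ea //; lia.
- have := le ((tsize a).+1 + i); have := lab ((tsize a).+1 + i).
  by rewrite [in last_desc (Node a' b') _]ea !last_desc_right; lia.
Qed.

(** * The interval-poset of a pair of bracketings *)

Section IntervalPoset.
Variable N : nat.
Implicit Types (e f : nat -> nat).

Definition dec_on e x y := [/\ 1 <= y, y < x, x <= e y & x <= N].
Definition inc_on f x y := [/\ 1 <= x, x < y, y <= N & forall z, x <= z < y -> f z < y].
Definition ip_on e f x y := [\/ x = y, dec_on e x y | inc_on f x y].

Lemma eq_ip_on e f e' f' x y :
  (forall i, 1 <= i <= N -> e i = e' i) -> (forall i, 1 <= i <= N -> f i = f' i) ->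
  ip_on e f x y -> ip_on e' f' x y.
Proof.
move=> ee ff [->|[h1 h2 h3 h4]|[h1 h2 h3 h4]]; first by constructor 1.
- by constructor 2; split; rewrite -?ee //; lia.
- by constructor 3; split=> // z hz; rewrite -ff ?h4 //; lia.
Qed.

(** By nesting, a step from [x] to [f x + 1] jumps over no bracket reaching its end. Conversely
    [f x + 1 <= y], and the condition persists from there, so one inducts on [y - x]. *)
Lemma clos_trans_inc_on f x y : bracketing N f ->
  clos_trans nat (fun i k => [/\ 1 <= i <= N, k = (f i).+1 & k <= N]) x y <-> inc_on f x y.
Proof.
move=> [f1 f2]; split=> [|[hx lxy hy hf]].
  elim=> {x y} [x _ [hx -> hN]|x y z _ [h1 h2 h3 h4] _ [h5 h6 h7 h8]].
    have := f1 x; split; try lia.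
    by move=> z hz; case: (ltngtP x z) => h; [have := f2 x z| |rewrite -h]; lia.
  split; try lia.
  by move=> w hw; have := h4 w; have := h8 w; lia.
move: {2}(y - x) (leqnn (y - x)) => k.
elim: k x hx lxy hf => [|k IH] x hx lxy hf hk; first by lia.
have := f1 x; have := hf x => hfx h1x.
have [e|ne] := eqVneq (f x).+1 y; first by apply: t_step; split=> //; lia.
apply: (t_trans _ _ _ (f x).+1); first by apply: t_step; split=> //; lia.
by apply: IH; try lia; move=> z hz; apply: hf; lia.
Qed.

Lemma ip_on_trans e f x y z : bracketing N e -> bracketing N f ->
  (forall i, 1 <= i <= N -> e i <= f i) ->
  ip_on e f x y -> ip_on e f y z -> ip_on e f x z.
Proof.
move=> [e1 e2] [f1 f2] ef [->//|[x1 x2 x3 x4]|[x1 x2 x3 x4]] [<-|[y1 y2 y3 y4]|[y1 y2 y3 y4]];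
  try by [constructor 2; split|constructor 3; split].
- by constructor 2; split; try lia; have := e2 z y; have := e1 z; lia.
(* Here [x <= e y <= f y < z], so the composite is increasing. *)
- have := ef y; have := y4 y.
  by constructor 3; split; try lia; move=> w hw; apply: y4; lia.
(* If [z] were in [[x, y)], then [f z < y <= e z], against [e z <= f z]; so [z < x] and the
   composite is decreasing. *)
- have := ef z; have := ef x; have := x4 x; have := x4 z.
  by constructor 2; split; lia.
- constructor 3; split; try lia.
  by move=> w hw; have := x4 w; have := y4 w; lia.
Qed.

Lemma ip_on_interval_poset e f : bracketing N e -> bracketing N f ->
  (forall i, 1 <= i <= N -> e i <= f i) -> interval_poset N (ip_on e f).
Proof.
move=> be bf ef; split.
- by move=> x _; constructor 1.
- move=> x y _ _ [//|[x1 x2 x3 x4]|[x1 x2 x3 x4]] [//|[y1 y2 y3 y4]|[y1 y2 y3 y4]].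
  + lia.
  + by have := y4 y; have := ef y; lia.
  + by have := x4 x; have := ef x; lia.
  + lia.
- by move=> x y z _ _ _; apply: ip_on_trans.
- move=> a b c ha ab bc hc; split=> -[?|[x1 x2 x3 x4]|[x1 x2 x3 x4]]; try lia.
  + by constructor 3; split; try lia; move=> z hz; apply: x4; lia.
  + by constructor 2; split; lia.
Qed.

(** [e i] is the largest source of a decreasing pair into [i], and [f i + 1] the least target of an
    increasing pair from [i]; enlarging the relation raises the first and lowers the second. *)
Lemma ip_on_le e f e' f' : bracketing N e -> bracketing N f ->
  bracketing N e' -> bracketing N f' ->
  (forall x y, 1 <= x <= N -> 1 <= y <= N -> ip_on e f x y -> ip_on e' f' x y) ->
  forall i, 1 <= i <= N -> e i <= e' i /\ f' i <= f i.
Proof.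
move=> [be _] [bf bf2] [be' _] [bf' _] sub i hi; have := be i hi; have := be' i hi.
have := bf i hi; have := bf' i hi; move=> h1 h2 h3 h4; split.
- have [//|lt] := leqP (e i) i; first by lia.
  have [||||[]|[]] := sub (e i) i; try lia.
  by constructor 2; split; lia.
- have [|lt] := leqP N (f i); first by lia.
  have [||||[]|[_ _ _ /(_ i)]] := sub i (f i).+1; try lia.
  constructor 3; split; try lia.
  by move=> z hz; have := bf2 i z; case: (ltngtP i z) => [||<-]; lia.
Qed.

(** * Reading two bracketings off an interval-poset *)

(** The index just before [a] first holds after [x]; a failed search returns the length [N - x],
    giving [N]. *)
Definition last_before (a : pred nat) x :=
  x + find (fun k => a (x + k.+1)) (iota 0 (N - x)).

Lemma last_beforeP a x (k := last_before a x) : x <= N ->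
  [/\ x <= k <= N, forall y, x < y <= k -> ~~ a y & k < N -> a k.+1].
Proof.
rewrite {}/k /last_before; set h := fun k => _; set s := iota _ _ => hx.
have ss : size s = N - x by rewrite size_iota.
have := find_size h s; rewrite ss => le; split=> [|y hy|lt]; first by lia.
- have hlt : y - x.+1 < find h s by lia.
  have /negbT := before_find 0 hlt; rewrite nth_iota; last by lia.
  by rewrite /h (_ : x + _ = y) //; lia.
- have : has h s by rewrite has_find ss; lia.
  move/(nth_find 0); rewrite nth_iota; last by lia.
  by rewrite add0n {1}/h addnS.
Qed.

Lemma interval_poset_ip_on (R : relation nat) : interval_poset N R ->
  exists e f, [/\ bracketing N e, bracketing N f,
    forall i, 1 <= i <= N -> e i <= f i & rel_eq_on N (ip_on e f) R].
Proof.
case=> Rr Ra Rt Ri.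
pose b x y := if excluded_middle_informative (R x y) then true else false.
have bP x y : reflect (R x y) (b x y).
  by rewrite /b; case: excluded_middle_informative => ?; constructor.
pose e x := last_before (fun y => ~~ b y x) x.
pose f x := last_before (fun y => b x y) x.
have eP x : 1 <= x <= N ->
    [/\ x <= e x <= N, forall y, x < y <= e x -> R y x & e x < N -> ~ R (e x).+1 x].
  case/andP=> _ /(last_beforeP (fun y => ~~ b y x)) [h1 h2 h3]; split=> //.
    by move=> y /h2; rewrite negbK => /bP.
  by move/h3/bP.
have fP x : 1 <= x <= N ->
    [/\ x <= f x <= N, forall y, x < y <= f x -> ~ R x y & f x < N -> R x (f x).+1].
  case/andP=> _ /(last_beforeP (fun y => b x y)) [h1 h2 h3]; split=> //.
    by move=> y /h2 /bP.
  by move/h3/bP.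
(* If [e i < e j], then [e i + 1] is related to [j] and [j] to [i], so [e i] was not maximal. *)
have be : bracketing N e.
  split=> [i /eP[]//|i j hi hj]; rewrite leqNgt; apply/negP => lt.
  have [i1 i2 i3] := eP i hi; have /eP [j1 j2 j3] : 1 <= j <= N by lia.
  apply: i3; first by lia.
  by apply: (Rt _ j); try lia; [apply: j2|apply: i2]; lia.
(* If [f i < f j], the interval axiom moves the pair [(i, f i + 1)] to [(j, f i + 1)], which [f j]
   forbids. *)
have bf : bracketing N f.
  split=> [i /fP[]//|i j hi hj]; rewrite leqNgt; apply/negP => lt.
  have [i1 i2 i3] := fP i hi; have /fP [j1 j2 j3] : 1 <= j <= N by lia.
  apply: (j2 (f i).+1); first by lia.
  by apply: (Ri i _ _ _ _ _ _).1; try lia; apply: i3; lia.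
exists e, f; split=> //.
  move=> i hi; rewrite leqNgt; apply/negP => lt.
  have [e1 e2 e3] := eP i hi; have [f1 f2 f3] := fP i hi.
  (* With [f i < e i], [i] and [f i + 1] are related both ways, against antisymmetry. *)
  suff : i = (f i).+1 by lia.
  by apply: Ra => //; [lia|apply: f3; lia|apply: e2; lia].
move=> x y hx hy; split=> [[<-|[h1 h2 h3 h4]|]|Rxy].
- exact: Rr.
- by have [_ + _] := eP y hy; apply; lia.
- move/(clos_trans_inc_on x y bf) => cl.
  suff [] : [/\ 1 <= x, x < y, y <= N & R x y] by [].
  elim: cl => {x y hx hy} [x _ [hx -> hN]|x y z _ [x1 x2 x3 x4] _ [y1 y2 y3 y4]].
    have [f1 f2 f3] := fP x hx.
    by split; try lia; apply: f3.
  by split; try lia; apply: (Rt _ y) => //; lia.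
- case: (ltngtP x y) => [lt|lt|->]; last by constructor 1.
  + constructor 3; split; try lia.
    move=> z hz; rewrite ltnNge; apply/negP => le.
    have [|_ /(_ y) + _] := fP z; first by lia.
    apply; first by lia.
    (* The interval axiom turns [R x y] into [R z y], which [y <= f z] excludes. *)
    by have [->//|ne] := eqVneq z x; apply: (Ri x _ _ _ _ _ _).1 => //; lia.
  + constructor 2; split; try lia.
    rewrite leqNgt; apply/negP => le.
    have [e1 _ []] := eP y hy; first by lia.
    have [->//|ne] := eqVneq (e y).+1 x; apply: (Ri _ _ x _ _ _ _).2 => //; lia.
Qed.

End IntervalPoset.

(** * [IP] in terms of trees *)

Lemma dec_relE t j i : dec_rel (word t) j i <-> dec_on (tsize t) (last_desc t) j i.
Proof.
rewrite /dec_rel /nup count_up_word; split=> [[hi hj ne]|[h1 h2 h3 h4]].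
- by rewrite upos_ltn // upos_lt_mate // => h; split; lia.
- by rewrite upos_ltn ?upos_lt_mate; try lia; split; lia.
Qed.

(** The up-steps before the mate of [i] are those labelled up to [last_desc t i], so the first one
    after it has the next label. *)
Lemma inc_baseE t i k : inc_base (word t) i k <->
  [/\ 1 <= i <= tsize t, k = (last_desc t i).+1 & k <= tsize t].
Proof.
rewrite /inc_base /nup count_up_word; split=> [[hi hk]|[hi -> hk]].
- rewrite mate_lt_upos // => lt all; split; try lia.
  apply/eqP; rewrite eqn_leq lt andbT leqNgt; apply/negP => lt'.
  have := all (last_desc t i).+1; rewrite upos_lt_mate //; lia.
- split=> //; first by rewrite mate_lt_upos.
  by move=> k' hk'; rewrite upos_lt_mate //; lia.
Qed.

Lemma clos_trans_iff (T : Type) (R S : relation T) :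
  (forall x y, R x y <-> S x y) -> forall x y, clos_trans T R x y <-> clos_trans T S x y.
Proof.
move=> RS x y; split; elim=> [{}x {}y /RS h|u v w _ h1 _ h2];
  by [apply: t_step|apply: t_trans h1 h2].
Qed.

Lemma inc_relE t x y : inc_rel (word t) x y <-> inc_on (tsize t) (last_desc t) x y.
Proof.
rewrite -clos_trans_inc_on; last exact: last_desc_bracketing.
by apply: clos_trans_iff => i k; apply: inc_baseE.
Qed.

(** [ip_on] is already reflexive and transitive, so the closure adds no pairs. *)
Lemma IPE p q x y : desc_le p q ->
  IP (word p) (word q) x y <-> ip_on (tsize p) (last_desc p) (last_desc q) x y.
Proof.
move=> [sz le]; split.
- elim=> {x y} [x y [/dec_relE h|/inc_relE]|x|x y z _ h1 _ h2].
  + by constructor 2.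
  + by rewrite -sz => h; constructor 3.
  + by constructor 1.
  + apply: ip_on_trans (last_desc_bracketing p) _ le h1 h2.
    by rewrite sz; apply: last_desc_bracketing.
- case=> [->|h|h]; first exact: rt_refl.
  + by apply/rt_step/or_introl/dec_relE.
  + by apply/rt_step/or_intror/inc_relE; rewrite -sz.
Qed.

(** * Run lengths and the chain condition *)

Lemma count_take_run (P : seq bool) p l : (forall k, k < l -> nth false P (p + k)) ->
  count id (take (p + l) P) = count id (take p P) + l.
Proof.
elim: l => [|l IH] h; first by rewrite !addn0.
have hl := h l (ltnSn l); rewrite addnS (take_nth false); last first.
  by rewrite ltnNge; apply/negP => le; rewrite nth_default in hl.
rewrite -cats1 count_cat IH /= ?hl; last by move=> k hk; apply: h; lia.
by rewrite addn0 addn1 addnS.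
Qed.

Lemma count_take_down (P : seq bool) p : ~~ nth false P p ->
  count id (take p.+1 P) = count id (take p P).
Proof.
have [lt|le] := ltnP p (size P); last by rewrite !take_oversize //; lia.
by rewrite (take_nth false) // -cats1 count_cat /= => /negbTE ->; rewrite !addn0.
Qed.

Lemma nth_run_len (P : seq bool) p :
  (forall k, k < run_len P p -> nth false P (p + k)) /\ ~~ nth false P (p + run_len P p).
Proof.
rewrite /run_len; split=> [k hk|].
  by have := before_find false hk; rewrite nth_drop => /negbFE.
rewrite -nth_drop; have [h|h] := boolP (has negb (drop p P)); first exact: nth_find.
by rewrite nth_default // leqNgt -has_find.
Qed.

Lemma run_start (P : seq bool) p : exists s,
  [/\ s <= p, (s == 0) || ~~ nth false P s.-1 & forall q, s <= q < p -> nth false P q].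
Proof.
elim: p => [|p [s [h1 h2 h3]]]; first by exists 0; split.
have [up|down] := boolP (nth false P p); last by exists p.+1; split=> // q; lia.
exists s; split=> //; first by lia.
move=> q hq; have [->//|ne] := eqVneq q p.
by apply: h3; lia.
Qed.

(** The up-steps before a down-step form complete runs, and a run length is a difference of two such
    counts. Positions past the end read as down-steps by the default of [nth]. *)
Lemma runs_dvdP (m : nat) (P : seq bool) :
  (forall p, p < size P -> nth false P p -> (p == 0) || ~~ nth false P p.-1 ->
     m %| run_len P p) <->
  (forall p, ~~ nth false P p -> m %| count id (take p P)).
Proof.
split=> [runs|down] p.
- elim/ltn_ind: p => p IH hp.
  have [s [sp s0 sup]] := run_start P p.
  have cs : m %| count id (take s P).
    case: s s0 sp {sup} => [|s] /= s0 sp; first by rewrite take0.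
    by rewrite count_take_down // IH.
  have -> : p = s + (p - s) by lia.
  rewrite count_take_run => [|k hk]; last by apply: sup; lia.
  rewrite dvdn_addr //; have [lt|ge] := ltnP s p; last first.
    by rewrite (_ : p - s = 0) ?dvdn0 //; lia.
  have ups := sup s; have [r1 r2] := nth_run_len P s.
  have <- : run_len P s = p - s.
    case: (ltngtP (run_len P s) (p - s)) => // h.
    + by rewrite sup in r2; lia.
    + by have := r1 _ h; rewrite subnKC // (negbTE hp).
  apply: runs => //; last by apply: ups; lia.
  by rewrite ltnNge; apply/negP => le; rewrite nth_default // in ups; have := ups; lia.
- move=> _ _ p0; have [r1 r2] := nth_run_len P p.
  have := down _ r2; rewrite count_take_run // dvdn_addr //.
  case: p p0 {r1 r2} => [|p] /= p0; first by rewrite take0.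
  by rewrite count_take_down // down.
Qed.

Lemma word_head a w : 0 < tsize a -> nth false (word a ++ w) 0.
Proof.
move=> ha; have := word_prefix a 1; have := count_up_word a.
by case: (word a) => [|[] s] /=; rewrite ?take0 /=; lia.
Qed.

(** A run ends at up-step [i] iff its right subtree is empty, that is [last_desc t i = i]; the
    number of up-steps so far is then [i]. *)
Lemma in_M_word n m t : in_M n m (word t) <-> tsize t = n * m /\
  forall i, 1 <= i <= tsize t -> ~~ (m %| i) -> i < last_desc t i.
Proof.
rewrite /in_M runs_dvdP; split=> [[dt down]|[sz desc]].
- split.
    by case/andP: dt => /andP[/eqP <- _] _; rewrite count_up_word.
  case=> // i hi nd; rewrite -[X in X < _]addn0 ltn_add2l lt0n; apply/eqP => e0.
  have [u [a [v [ew cu sa]]]] := split_word hi.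
  case: a ew sa => [|c d] ew sa; last by rewrite [_.-1]/= in e0; rewrite e0 in sa.
  have := down (size u).+1; rewrite ew nth_cat take_cat !ltnNge !leqnSn /= subSnn /= ?take0.
  by rewrite count_cat cu /= addn1 (negbTE nd) => /(_ isT).
- split; first by rewrite -sz word_dyck.
  elim=> [|p IH] hp; first by rewrite take0.
  have [up|dn] := boolP (nth false (word t) p); last by rewrite count_take_down // IH.
  have lt : p < size (word t).
    by rewrite ltnNge; apply/negP => le; rewrite nth_default in up.
  rewrite (take_nth false) // up -cats1 count_cat /= addn1.
  apply/negPn/negP => nd.
  have hc : count id (take p (word t)) < tsize t.
    rewrite -count_up_word -[in X in _ < X](cat_take_drop p (word t)).
    by rewrite (drop_nth false) // up count_cat /=; lia.
  have := desc (count id (take p (word t))).+1; rewrite /last_desc /=.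
  have [u [a [v [ew cu <-]]]] := split_word hc.
  have ps : p = size u.
    rewrite -(upos_cat u (word a ++ false :: v)) -ew cu.
    rewrite -{1}(cat_take_drop p (word t)) (drop_nth false) // up upos_cat size_takel //.
    exact: ltnW.
  move: hp; rewrite ew ps nth_cat ltnNge leqnSn /= subSnn /= => hp.
  (* An empty right subtree contradicts [desc]; a nonempty one puts an up-step right after position
     [p]. *)
  have [->|a0] := posnP (tsize a); first by rewrite addn0 ltnn -ps -ew hc => /(_ isT nd).
  by rewrite word_head in hp.
Qed.

Lemma chain_condE n m t R : (forall i, 1 <= i < n * m -> R i.+1 i <-> i < last_desc t i) ->
  chain_cond n m R <-> forall i, 1 <= i <= n * m -> ~~ (m %| i) -> i < last_desc t i.
Proof.
move=> hR; split=> [ch i hi nd|h i k hi hk].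
- have m0 : 0 < m by case: m nd hi {hR ch} => //; rewrite muln0; lia.
  have r0 : 0 < i %% m by rewrite lt0n.
  have rm : i %% m < m by rewrite ltn_mod.
  (* With [i = q * m + r] and [0 < r < m], the pair [(i + 1, i)] lies in block [q + 1] at offset
     [m - r - 1]. *)
  move: (divn_eq i m) r0 rm; move: (i %/ m) (i %% m) => q r ei r0 rm.
  have le : q.+1 <= n.
    by rewrite ltnNge; apply/negP => le; have := leq_mul le (leqnn m); lia.
  have lem : q.+1 * m <= n * m by rewrite leq_mul.
  rewrite mulSn in lem; apply/hR; first by lia.
  have := ch q.+1 (m - r).-1.
  rewrite mulSn (_ : _ - (_).-1 = i.+1); last by lia.
  by rewrite (_ : _ - (_).-1.+1 = i); [apply|]; lia.
- have hm : m <= i * m <= n * m by rewrite leq_pmull ?leq_mul //; lia.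
  rewrite (_ : i * m - k = (i * m - k.+1).+1); last by lia.
  apply/hR; first by lia.
  apply: h; first by lia.
  rewrite dvdn_subr //; last by apply: dvdn_mull.
    by apply/negP => /dvdn_leq; lia.
  by lia.
Qed.

(** * Well-definedness, injectivity and surjectivity for paths with runs divisible by [m] *)

Unset Implicit Arguments.
Set Strict Implicit.

Theorem theorem4p6 (n m : nat) (hn : 1 <= n) (hm : 1 <= m) :
  (* well-defined: IP(P,Q) is an interval-poset with the chain condition *)
  (forall P Q, in_M n m P -> in_M n m Q -> tamari_le P Q ->
     interval_poset (n * m) (IP P Q) /\ chain_cond n m (IP P Q)) /\
  (* injective *)
  (forall P Q P' Q', in_M n m P -> in_M n m Q -> tamari_le P Q ->
     in_M n m P' -> in_M n m Q' -> tamari_le P' Q' ->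
     rel_eq_on (n * m) (IP P Q) (IP P' Q') -> P = P' /\ Q = Q') /\
  (* surjective *)
  (forall R, interval_poset (n * m) R -> chain_cond n m R ->
     exists P Q, [/\ in_M n m P, in_M n m Q, tamari_le P Q &
                     rel_eq_on (n * m) (IP P Q) R]).
Proof.
set N := n * m.
have step (R : relation nat) e f i : rel_eq_on N (ip_on N e f) R -> 1 <= i < N ->
    R i.+1 i <-> i < e i.
  move=> eR hi; rewrite -eR; try lia.
  split=> [[|[]|[]]|h]; try lia.
  by constructor 2; split; lia.
have inM_tree P : in_M n m P -> exists2 t, P = word t & tsize t = N.
  by case=> /dyck_word.
have IPw p q : tsize p = N -> tamari_le (word p) (word q) ->
    rel_eq_on N (ip_on N (last_desc p) (last_desc q)) (IP (word p) (word q)).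
  by move=> sp /tamari_desc_le le x y _ _; rewrite (IPE x y le) sp.
split; [|split].
- move=> P Q MP MQ; have [p eP sp] := inM_tree P MP; have [q eQ sq] := inM_tree Q MQ.
  rewrite {}eP {}eQ in MP MQ * => pq; have eIP := IPw p q sp pq.
  have [_ le] := tamari_desc_le pq.
  have [bp bq] := (last_desc_bracketing p, last_desc_bracketing q).
  rewrite sp sq in le bp bq; split.
    have [i1 i2 i3 i4] := ip_on_interval_poset bp bq le.
    split.
    + by move=> x hx; apply/eIP => //; apply: i1.
    + by move=> x y hx hy /(eIP _ _ hx hy) h1 /(eIP _ _ hy hx); apply: i2.
    + move=> x y z hx hy hz /(eIP _ _ hx hy) h1 /(eIP _ _ hy hz) h2.
      by apply/eIP => //; apply: i3 h1 h2.
    + move=> a b c h1 h2 h3 h4; rewrite -!eIP; try lia.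
      exact: i4.
  apply/(chain_condE (t := p)); first by move=> i; apply: (step _ _ _ i eIP).
  by case/in_M_word: MP; rewrite sp.
- move=> P Q P' Q' MP MQ + MP' MQ'.
  have [p -> sp] := inM_tree P MP; have [q -> sq] := inM_tree Q MQ.
  have [p' -> sp'] := inM_tree P' MP'; have [q' -> sq'] := inM_tree Q' MQ'.
  move=> pq pq' eIP.
  have E := IPw p q sp pq; have E' := IPw p' q' sp' pq'.
  have [bp bq] := (last_desc_bracketing p, last_desc_bracketing q).
  have [bp' bq'] := (last_desc_bracketing p', last_desc_bracketing q').
  rewrite sp sq sp' sq' in bp bq bp' bq'.
  (* The two inclusions of the relations give opposite inequalities, hence equal bracketings. *)
  have le := ip_on_le bp bq bp' bq' (fun x y hx hy h =>
    (E' x y hx hy).2 ((eIP x y hx hy).1 ((E x y hx hy).1 h))).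
  have ge := ip_on_le bp' bq' bp bq (fun x y hx hy h =>
    (E x y hx hy).2 ((eIP x y hx hy).2 ((E' x y hx hy).1 h))).
  suff H i : 1 <= i <= N ->
      last_desc p i = last_desc p' i /\ last_desc q i = last_desc q' i.
    by split; congr word; apply: last_desc_inj; rewrite ?sp ?sq // => i /H [].
  move=> hi; have [l1 l2] := le i hi; have [g1 g2] := ge i hi.
  by split; lia.
- move=> R iR cR; have [e [f [be bf le eR]]] := interval_poset_ip_on iR.
  have [p sp ep] := bracketing_tree be; have [q sq eq] := bracketing_tree bf.
  have lepq : desc_le p q.
    by split=> [|i]; rewrite sp ?sq // => hi; rewrite ep ?eq ?le.
  have tpq : tamari_le (word p) (word q) by apply/tamari_word/desc_le_tle.
  have chp i : 1 <= i <= N -> ~~ (m %| i) -> i < last_desc p i.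
    move=> hi; move: i hi; apply/(chain_condE (R := R)) => // i hi.
    by rewrite (step _ _ _ _ eR) // ep //; lia.
  exists (word p), (word q); split=> //.
  + by apply/in_M_word; rewrite sp; split.
  (* The condition passes from [p] to [q] because [i < last_desc p i <= last_desc q i]. *)
  + apply/in_M_word; rewrite sq; split=> // i hi nd.
    apply: leq_trans (chp i hi nd) _; case: lepq => _; apply; lia.
  + move=> x y hx hy; rewrite -IPw // -eR //; split; apply: eq_ip_on => i /[dup] hi;
      by [apply: ep|apply: eq|move/ep|move/eq].
Qed.
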